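(* With polynomials $x$ restricted to $\deg(x)\le 4$, the number $\delta=\frac{\sqrt{10+2\sqrt{5}}}{4}$ is quasi-admissible and every real $\delta<\frac{\sqrt{10+2\sqrt{5}}}{4}$ is admissible. That is, $\frac{\sqrt{10+2\sqrt{5}}}{4}$ is quasi-admissible by some $x,y$ with $\deg(x)\le 4$, and every real $\delta<\frac{\sqrt{10+2\sqrt{5}}}{4}$ is admissible by some $x,y$ with $\deg(x)\le 4$.
   Context: A polynomial $p(s)\in\mathbb{R}[s]$ is stable if every complex root $t$ of $p$ satisfies $\mathrm{Re}(t)<0$, and quasi-stable if every complex root $t$ of $p$ satisfies $\mathrm{Re}(t)\le 0$. (Nonzero constants are stable; the zero polynomial is neither stable nor quasi-stable.) Let $H$ be the set of stable polynomials in $\mathbb{R}[s]$ and $\overline{H}$ the set of quasi-stable polynomials in $\mathbb{R}[s]$. A real number $\delta$ is admissible by $x,y$ if $x,y\in H$, $\deg(x)\ge\deg(y)$, and $(s^2-2\delta s+1)x(s)+(s^2-1)y(s)\in H$. A real number $\delta$ is quasi-admissible by $x,y$ if $x,y\in\overline{H}$, $\deg(x)\ge\deg(y)$, and $(s^2-2\delta s+1)x(s)+(s^2-1)y(s)\in\overline{H}$. *)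

(* Defs.v *)
From mathcomp Require Import all_boot all_order all_algebra.
From mathcomp Require Import complex.
From mathcomp Require Import reals.

Set Implicit Arguments.
Unset Strict Implicit.
Unset Printing Implicit Defensive.

Import GRing.Theory Num.Theory.
Local Open Scope ring_scope.

(* The zero polynomial is excluded from both classes, since every complex
   number is a root of it. *)
Definition stable (R : realType) (p : {poly R}) : Prop :=
  forall t : R[i], root (map_poly (real_complex R) p) t -> complex.Re t < 0.

Definition quasi_stable (R : realType) (p : {poly R}) : Prop :=
  forall t : R[i], root (map_poly (real_complex R) p) t -> complex.Re t <= 0.

Definition closed_loop (R : realType) (delta : R) (x y : {poly R}) : {poly R} :=
  ('X^2 - (2 * delta) *: 'X + 1) * x + ('X^2 - 1) * y.

(* [size] is the degree plus one on nonzero polynomials, and (quasi-)stable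
   polynomials are nonzero, so [size y <= size x] says deg y <= deg x. *)
Definition admissible_by (R : realType) (delta : R) (x y : {poly R}) : Prop :=
  [/\ stable x, stable y, (size y <= size x)%N
    & stable (closed_loop delta x y)].

Definition quasi_admissible_by (R : realType) (delta : R) (x y : {poly R})
    : Prop :=
  [/\ quasi_stable x, quasi_stable y, (size y <= size x)%N
    & quasi_stable (closed_loop delta x y)].

(* Main.v *)
Require Import Defs.
From mathcomp Require Import all_boot all_order all_algebra.
From mathcomp Require Import complex.
From mathcomp Require Import reals.
From mathcomp Require Import ring lra.

Import GRing.Theory Num.Theory Order.TTheory.
Local Open Scope ring_scope.

(** Write [e := 2 delta], [D := e^2].  If [y] is a constant multiple of a
    polynomial with constant term 1, the low coefficients of [x] can be chosen
    so that those of the closed loop vanish: [x] then starts as the power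
    series of [(1 - s^2) y / (s^2 - e s + 1)].  At the extremal [delta], where
    [D^2 - 5 D + 5 = 0], this can be pushed until the closed loop is [s^6]:
    with [phi] the golden ratio, [D = phi + 2] and
      [(s^4 - phi s^2 + 1) (s^2 + phi) + (s^2 - 1) phi = s^6],
    so [x = (s^2 + e s + 1) (s^2 + phi)] and [y = phi] are quasi-stable.

    Below the extremal value the same idea leaves room for [x] and
    [y = 1 + tau s] to be strictly stable and for the closed loop to be
    [s^k q] with [q] stable and quadratic: [k = 2] and [deg x = 2] suffice for
    [0 <= delta <= 4/5] (lemma [admissible_low]), while [k = 4] and
    [deg x = 4] reach up to the extremal value (lemma [admissible_high]).  For
    [delta < 0] constants [x] and [y] do.

    The [k] roots at the origin are then moved into the open left half plane
    one by one.  Replacing a factor [s] of the closed loop by [s + h] changes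
    it by [h] times a polynomial.  As [s^2 - e s + 1] and [s^2 - 1] are coprime,
    this change comes from changes of [x] and [y] proportional to [h] which do
    not raise the degrees provided that [deg y >= 1].  For small [h] they
    preserve stability, because stability is an open condition in bounded
    degree (lemma [stable_open]).  Stability of the explicit quadratics and
    quartics follows from Routh's recursion (lemma [stable_routh]). *)

(** * Stable polynomials in the closed right half plane *)

Local Notation toC p := (map_poly (real_complex _) p).

Lemma stable_neq0 (R : realType) (p : {poly R}) : stable p -> p != 0.
Proof.
move=> sp; apply/eqP=> p0; have := sp 1.
by rewrite p0 rmorph0 root0 => /(_ isT); rewrite /= ltr10.
Qed.

Lemma stable_horner_neq0 (R : realType) (p : {poly R}) (t : R[i]) :
  stable p -> 0 <= complex.Re t -> (toC p).[t] != 0.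
Proof. by move=> sp t0; apply/negP=> /sp; rewrite ltNge t0. Qed.

Lemma stableC (R : realType) (c : R) : c != 0 -> stable c%:P.
Proof.
by move=> c0 t; rewrite map_polyC rootC /= fmorph_eq0 (negPf c0).
Qed.

Lemma stableM (R : realType) (p q : {poly R}) :
  stable p -> stable q -> stable (p * q).
Proof. by move=> sp sq t; rewrite rmorphM rootM => /orP[/sp | /sq]. Qed.

Lemma stable_XaddC (R : realType) (c : R) : 0 < c -> stable ('X + c%:P).
Proof.
move=> c0 [a b]; rewrite rmorphD /= map_polyX map_polyC /root !hornerE /=.
rewrite eq_complex /= => /andP[/eqP ac _]; lra.
Qed.

(** Over the complex numbers a stable polynomial is a product of linear
    factors, so estimates in the closed right half plane reduce to one factor
    [t - z] with [Re z < 0]. *)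
Lemma stable_factor (R : realType) (p : {poly R}) : stable p ->
  exists (c : R[i]) (rs : seq R[i]),
    [/\ c != 0, {in rs, forall z, complex.Re z < 0}, size p = (size rs).+1
      & forall t, (toC p).[t] = c * \prod_(z <- rs) (t - z)].
Proof.
move=> sp; have p0 := stable_neq0 _ _ sp.
have [rs prs] := closed_field_poly_normal (toC p).
have c0 : lead_coef (toC p) != 0 by rewrite lead_coef_eq0 map_poly_eq0.
exists (lead_coef (toC p)), rs; split=> //.
- move=> z zrs; apply: sp; rewrite prs rootZ // root_prod_XsubC //.
- by rewrite -(size_map_poly (real_complex R)) prs size_scale // size_prod_XsubC.
- move=> t; rewrite {1}prs hornerZ horner_prod; congr (_ * _).
  by apply: eq_bigr => z _; rewrite !hornerE.
Qed.

(** Reflecting [t] in the imaginary axis brings it closer to every point of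
    the left half plane. *)
Lemma le_norm_reflect (R : realType) (t z : R[i]) :
  0 <= complex.Re t -> complex.Re z < 0 ->
  `|- conjc t - z| <= `|t - z|.
Proof.
case: t z => [a b] [c d] /= a0 c0.
rewrite !normc_def /= lecR ler_sqrt ?addr_ge0 ?sqr_ge0 //; nra.
Qed.

Lemma horner_toC_conj (R : realType) (p : {poly R}) (t : R[i]) :
  (toC p).[conjc t] = conjc (toC p).[t].
Proof.
have {1}-> : toC p = map_poly conjc (toC p).
  by rewrite -map_poly_comp; apply: eq_map_poly => x /=; rewrite oppr0.
by rewrite horner_map.
Qed.

(** For a real polynomial [p.[- t]] and [p.[- t^*]] are conjugate, and
    [- t^*] is the reflection of [t] in the imaginary axis. *)
Lemma stable_horner_opp (R : realType) (p : {poly R}) (t : R[i]) :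
  stable p -> 0 <= complex.Re t -> `|(toC p).[- t]| <= `|(toC p).[t]|.
Proof.
move=> /stable_factor [c [rs [_ rs0 _ pE]]] t0.
rewrite -[X in `|X|]conjcK normcJ -horner_toC_conj rmorphN /= !pE !normrM.
apply: ler_wpM2l => //; rewrite !normr_prod.
rewrite !big_seq; apply: ler_prod => z /rs0 z0.
by rewrite normr_ge0 le_norm_reflect.
Qed.

(** * Stability is an open condition *)

(** A factor [t - z] is at least [- Re z] in the right half plane, and of the
    size of [t] at infinity. *)
Lemma norm_factor_lb (R : realType) (z : R[i]) : complex.Re z < 0 ->
  exists2 m : R[i], 0 < m &
    forall t, 0 <= complex.Re t -> m * (1 + `|t|) <= `|t - z|.
Proof.
move=> z0; pose r := (- complex.Re z)%:C%C.
have r0 : 0 < r by rewrite ltcR oppr_gt0.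
have d0 : 0 < r + `|z| + 1 by rewrite -addrA ltr_pwDl // addr_ge0.
exists (r / (r + `|z| + 1)); first by rewrite divr_gt0.
move=> t t0; rewrite mulrAC ler_pdivrMr //.
have rt : r <= `|t - z|.
  apply: le_trans (normc_ge_Re _); rewrite /r lecR.
  apply: le_trans (ler_norm _); rewrite raddfB /=; lra.
have tz : `|t| <= `|t - z| + `|z| by rewrite -{1}(subrK z t) ler_normD.
have -> : `|t - z| * (r + `|z| + 1) = r * `|t - z| + `|t - z| * (1 + `|z|).
  by ring.
apply: le_trans (_ : r * `|t - z| + r * (1 + `|z|) <= _).
  by rewrite -mulrDr ler_pM2l // addrCA lerD2l.
by rewrite lerD2l ler_wpM2r // addr_ge0.
Qed.

Lemma stable_lower_bound (R : realType) (p : {poly R}) : stable p ->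
  exists2 m : R[i], 0 < m &
    forall t, 0 <= complex.Re t ->
      m * (1 + `|t|) ^+ (size p).-1 <= `|(toC p).[t]|.
Proof.
move=> /stable_factor [c [rs [c0 rs0 -> pE]]] /=.
suff [m m0 mP] : exists2 m : R[i], 0 < m & forall t, 0 <= complex.Re t ->
      m * (1 + `|t|) ^+ size rs <= `|\prod_(z <- rs) (t - z)|.
  exists (`|c| * m); first by rewrite mulr_gt0 // normr_gt0.
  by move=> t t0; rewrite pE normrM -mulrA ler_pM2l ?normr_gt0 // mP.
elim: rs rs0 {pE} => [|z rs IH] rs0.
  by exists 1 => // t _; rewrite big_nil normr1 mulr1.
have [m m0 mP] : exists2 m : R[i], 0 < m & forall t, 0 <= complex.Re t ->
      m * (1 + `|t|) ^+ size rs <= `|\prod_(z <- rs) (t - z)|.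
  by apply: IH => u urs; rewrite rs0 // inE urs orbT.
have [|n n0 nP] := norm_factor_lb _ z; first by rewrite rs0 // inE eqxx.
exists (n * m); first by rewrite mulr_gt0.
move=> t t0; rewrite big_cons normrM /= exprS mulrACA.
have ge0 : 0 <= 1 + `|t| by rewrite addr_ge0.
by apply: ler_pM; rewrite ?nP ?mP ?mulr_ge0 ?exprn_ge0 // ltW.
Qed.

Lemma horner_upper_bound (R : realType) (p : {poly R}) (n : nat) :
  (size p <= n.+1)%N ->
  forall t : R[i],
    `|(toC p).[t]| <= (\sum_(i < n.+1) `|p`_i|)%:C%C * (1 + `|t|) ^+ n.
Proof.
move=> sp t; rewrite (@horner_coef_wide _ n.+1); last first.
  by rewrite (leq_trans (size_poly _ _)).
apply: le_trans (ler_norm_sum _ _ _) _.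
rewrite rmorph_sum mulr_suml; apply: ler_sum => i _.
rewrite normrM normrX coef_map /=.
have -> : `|(p`_i)%:C%C| = `|p`_i|%:C%C.
  by rewrite normc_def /= expr0n addr0 sqrtr_sqr.
rewrite ler_wpM2l ?ler0c //.
apply: le_trans (_ : (1 + `|t|) ^+ i <= _).
  by rewrite lerXn2r ?nnegrE ?addr_ge0 // lerDr.
by rewrite ler_weXn2l ?lerDl // -ltnS.
Qed.

(** In the closed right half plane a stable [p] dominates every polynomial of
    no larger degree, so small multiples of such a polynomial create no root
    there. *)
Lemma stable_open (R : realType) (p e : {poly R}) :
  stable p -> (size e <= size p)%N ->
  exists2 eps : R, 0 < eps & forall h, 0 < h -> h < eps ->
    stable (p + h *: e) /\ size (p + h *: e) = size p.
Proof.
move=> sp se; have p0 := stable_neq0 _ _ sp.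
have [m m0 mP] := stable_lower_bound _ _ sp.
have sp1 : (size p).-1.+1 = size p by rewrite prednK // lt0n size_poly_eq0.
have := @horner_upper_bound R e (size p).-1; rewrite sp1 => /(_ se).
set S := \sum_(i < _) _ => eP.
have S0 : 0 <= S by apply: sumr_ge0.
have leS : `|e`_(size p).-1| <= S.
  have lt : ((size p).-1 < size p)%N by rewrite sp1.
  by rewrite /S (bigD1 (Ordinal lt)) //= lerDl sumr_ge0.
have lp : 0 < `|lead_coef p| by rewrite normr_gt0 lead_coef_eq0.
have mE : m = (complex.Re m)%:C%C by rewrite RRe_real // gtr0_real.
have m0' : 0 < complex.Re m by rewrite mE ltcR in m0.
pose d := Num.min `|lead_coef p| (complex.Re m).
have d0 : 0 < d by rewrite lt_min lp.
exists (d / (S + 1)); first by rewrite divr_gt0 // ltr_wpDl.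
move=> h h0; rewrite ltr_pdivlMr ?ltr_wpDl // => hd.
have {hd} hS : h * S < d by apply: le_lt_trans hd; rewrite ler_pM2l // lerDl.
have [hl hm] : h * S < `|lead_coef p| /\ h * S < complex.Re m.
  by move: hS; rewrite lt_min => /andP.
split.
  move=> t; rewrite /root => /eqP rt; rewrite ltNge; apply/negP => t0.
  have ge1 : 1 <= 1 + `|t| by rewrite lerDl.
  have P0 : 0 < (1 + `|t|) ^+ (size p).-1 by rewrite exprn_gt0 // ltr_wpDr.
  have : (toC p).[t] = - (h%:C%C * (toC e).[t]).
    apply/eqP; rewrite -addr_eq0 -rt rmorphD /= map_polyZ /=.
    by rewrite hornerD hornerZ.
  move/(congr1 Num.norm); rewrite normrN normrM => eqn.
  have := mP _ t0; rewrite eqn => H.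
  have hn : `|h%:C%C| = h%:C%C by rewrite ger0_norm // ler0c ltW.
  have : m * (1 + `|t|) ^+ (size p).-1
      <= (h * S)%:C%C * (1 + `|t|) ^+ (size p).-1.
    apply: le_trans H _; rewrite hn rmorphM /= -mulrA ler_wpM2l //.
    by rewrite ler0c ltW.
  by rewrite ler_pM2r // mE lecR leNgt hm.
apply/eqP; rewrite eqn_leq; apply/andP; split.
  rewrite (leq_trans (size_polyD _ _)) // geq_max leqnn /=.
  by rewrite (leq_trans (size_scale_leq _ _)).
rewrite -sp1 ltnNge; apply/negP => /leq_sizeP /(_ _ (leqnn _)).
rewrite coefD coefZ -/(lead_coef p) => /eqP; rewrite addr_eq0 => /eqP lpE.
move: hl; rewrite lpE normrN normrM gtr0_norm // ltNge ler_pM2l //.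
by rewrite leS.
Qed.

(** * Moving zero roots of the closed loop *)

Lemma closed_loop_perturb (R : realType) (d h : R) (x y u v : {poly R}) :
  closed_loop d (x + h *: u) (y + h *: v)
    = closed_loop d x y + h *: closed_loop d u v.
Proof. by rewrite /closed_loop -!mul_polyC; ring. Qed.

Lemma size_closed_loop_coef_x (R : realType) (d : R) :
  size ('X^2 - (2 * d) *: 'X + 1 : {poly R}) = 3%N.
Proof.
rewrite -addrA size_polyDl size_polyXn // ltnS.
rewrite (leq_trans (size_polyD _ _)) // geq_max size_poly1 andbT size_polyN.
by rewrite (leq_trans (size_scale_leq _ _)) // size_polyX.
Qed.

Lemma coprimep_closed_loop_coefs (R : realType) (d : R) : d != 1 -> d != -1 ->
  coprimep ('X^2 - (2 * d) *: 'X + 1) ('X^2 - 1 : {poly R}).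
Proof.
move=> d1 dN1.
have -> : 'X^2 - 1 = ('X - 1%:P) * ('X - (-1)%:P) :> {poly R}.
  by rewrite polyCN; ring.
rewrite coprimepMr !coprimep_XsubC /root !hornerE.
apply/andP; split.
  by apply: contra d1 => /eqP H; apply/eqP; lra.
by apply: contra dN1 => /eqP H; apply/eqP; lra.
Qed.

(** Solvability of the linearized problem: as the two coefficients of the
    closed loop are coprime of degree two, [Y] can be reduced modulo the first
    one, and then the degree of [X] follows from that of the right-hand side. *)
Lemma closed_loop_onto (R : realType) (d : R) (q : {poly R}) (n : nat) :
  d != 1 -> d != -1 -> (size q <= n.+1)%N -> (2 <= n)%N ->
  exists u v : {poly R},
    [/\ (size u <= n)%N, (size v <= 2)%N & closed_loop d u v = q].
Proof.
move=> d1 dN1 sq n2; have sa := size_closed_loop_coef_x R d.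
have := coprimep_closed_loop_coefs R d d1 dN1; rewrite /closed_loop.
set a := 'X^2 - _ + 1 in sa *; set m := 'X^2 - 1.
have a0 : a != 0 by rewrite -size_poly_eq0 sa.
move/Bezout_eq1_coprimepP=> [[f g] /= fg].
have sv : (size ((q * g) %% a)%R <= 2)%N by rewrite -ltnS -sa ltn_modp.
have eq : a * (q * f + m * ((q * g) %/ a)) + m * ((q * g) %% a) = q.
  transitivity (q * (f * a) + m * ((q * g) %/ a * a + (q * g) %% a)).
    by ring.
  by rewrite -divp_eq -[RHS]mulr1 -fg; ring.
exists (q * f + m * ((q * g) %/ a)), ((q * g) %% a); split=> //.
set u := q * f + _ in eq *; set v := (q * g) %% a in sv eq *.
have [->|u0] := eqVneq u 0; first by rewrite size_poly0.
have : (size (a * u)%R <= n.+2)%N.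
  have -> : a * u = q - m * v by rewrite -[q in RHS]eq addrK.
  rewrite (leq_trans (size_polyD _ _)) // geq_max size_polyN.
  rewrite (leq_trans sq) //= (leq_trans (size_polyMleq _ _)) //.
  have sm : size m = 3%N by rewrite /m size_polyDl size_polyXn // size_polyN size_poly1.
  by rewrite sm /= (leq_trans (_ : _ <= 4)%N) // ltnS ltnS.
by rewrite size_mul // sa.
Qed.

Lemma size_closed_loop_le (R : realType) (d : R) (x y : {poly R}) :
  (size y <= size x)%N -> (size (closed_loop d x y) <= (size x).+2)%N.
Proof.
move=> yx; rewrite (leq_trans (size_polyD _ _)) // geq_max.
rewrite !(leq_trans (size_polyMleq _ _)) ?size_closed_loop_coef_x //.
by rewrite size_polyDl size_polyXn ?size_polyN ?size_poly1 //= !ltnS.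
Qed.

(** A root of the closed loop at the origin can be pushed into the open left
    half plane: trading the factor ['X] for ['X + h] changes the closed loop
    by [h q], which is matched by changing [x] and [y] by small multiples of
    polynomials of no larger degree. *)
Lemma shift_zero_root (R : realType) (d : R) (x y q : {poly R}) :
  d != 1 -> d != -1 -> stable x -> stable y ->
  (2 <= size y)%N -> (size y <= size x)%N ->
  closed_loop d x y = 'X * q ->
  exists (x' y' : {poly R}) (h : R), [/\ stable x', stable y', size x' = size x, size y' = size y
    & 0 < h /\ closed_loop d x' y' = ('X + h%:P) * q].
Proof.
move=> d1 dN1 sx sy y2 yx cl.
have sq : (size q <= (size x).+1)%N.
  have [->|q0] := eqVneq q 0; first by rewrite size_poly0.
  by have := size_closed_loop_le R d x y yx; rewrite cl mulrC size_mulX.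
have [|u [v [su sv uv]]] := closed_loop_onto R d q (size x) d1 dN1 sq.
  exact: leq_trans y2 yx.
have [e1 e10 h1] := stable_open R x u sx su.
have [e2 e20 h2] := stable_open R y v sy (leq_trans sv y2).
pose h := Num.min e1 e2 / 2.
have e0 : 0 < Num.min e1 e2 by rewrite lt_min e10.
have h0 : 0 < h by rewrite divr_gt0.
have : h < Num.min e1 e2 by rewrite /h; lra.
rewrite lt_min => /andP[/(h1 _ h0)[? ?] /(h2 _ h0)[? ?]].
exists (x + h *: u), (y + h *: v), h; split=> //; split=> //.
by rewrite closed_loop_perturb cl uv mulrDl mul_polyC.
Qed.

(** It is therefore enough to reach a closed loop all of whose roots outside
    the open left half plane are at the origin, as long as [y] has the freedom
    of a linear term. *)
Lemma admissible_of_zero_roots (R : realType) (d : R) (k : nat)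
    (x y q : {poly R}) :
  d != 1 -> d != -1 -> stable x -> stable y -> stable q ->
  (2 <= size y)%N -> (size y <= size x)%N ->
  closed_loop d x y = 'X^k * q ->
  exists x' y' : {poly R}, size x' = size x /\ admissible_by d x' y'.
Proof.
move=> d1 dN1; elim: k x y q => [|k IH] x y q sx sy sq y2 yx cl.
  by exists x, y; split=> //; split=> //; rewrite cl expr0 mul1r.
rewrite exprS -mulrA in cl.
have [x1 [y1 [h [sx1 sy1 xE yE [h0 cl1]]]]] :=
  shift_zero_root R d x y _ d1 dN1 sx sy y2 yx cl.
have [||||x2 [y2' [x2E ad]]] := IH x1 y1 (('X + h%:P) * q) sx1 sy1.
- by apply: stableM => //; apply: stable_XaddC.
- by rewrite yE.
- by rewrite xE yE.
- by rewrite cl1; ring.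
by exists x2, y2'; rewrite x2E xE.
Qed.

(** * Routh-Hurwitz criteria in low degree *)

(** One step of Routh's table, read upwards: [q + (-1)^e q(-X)] is twice the even
    or the odd part of [q].  At a root [t] of the new polynomial in the closed
    right half plane, [w := b t] would satisfy [|1 + w| |q(t)| = |w| |q(-t)|],
    although [|1 + w| > |w|] and [|q(-t)| <= |q(t)| <> 0]. *)
Lemma stable_routh (R : realType) (q : {poly R}) (b : R) (e : bool) :
  stable q -> 0 < b ->
  stable (q + b%:P * 'X * (q + (-1) ^+ e * (q \Po (- 'X)))).
Proof.
move=> sq b0 t; rewrite /root => /eqP rt; rewrite ltNge; apply/negP => t0.
have q0 := stable_horner_neq0 _ _ _ sq t0.
have : (1 + b%:C%C * t) * (toC q).[t]
       = - ((-1) ^+ e * (b%:C%C * t) * (toC q).[- t]).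
  apply/eqP; rewrite -addr_eq0 -rt; apply/eqP.
  rewrite !(rmorphD, rmorphM, rmorphXn, rmorphN, rmorph1) /= map_polyX map_polyC.
  rewrite map_comp_poly rmorphN /= map_polyX.
  rewrite !(hornerD, hornerM, hornerX, hornerC, horner_exp, hornerN, horner_comp).
  by ring.
move/(congr1 Num.norm); rewrite normrN !normrM normrX normrN1 expr1n mul1r.
move=> eqn.
have : `|1 + b%:C%C * t| * `|(toC q).[t]| <= `|b%:C%C * t| * `|(toC q).[t]|.
  by rewrite eqn -normrM ler_wpM2l // stable_horner_opp.
rewrite ler_pM2r ?normr_gt0 //; case: t t0 {rt q0 eqn} => [x y] /= x0.
rewrite !normc_def /= lecR ler_sqrt ?addr_ge0 ?sqr_ge0 //.
have : 0 <= b * x by rewrite mulr_ge0 // ltW.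
nra.
Qed.

Lemma stable_linear (R : realType) (a1 a0 : R) : 0 < a1 -> 0 < a0 ->
  stable (a1%:P * 'X + a0%:P).
Proof.
move=> h1 h0.
have -> : a1%:P * 'X + a0%:P = a1%:P * ('X + (a0 / a1)%:P).
  by rewrite mulrDr -polyCM [a1 * _]mulrC divfK ?gt_eqF.
by apply: stableM; [apply: stableC; rewrite gt_eqF | apply/stable_XaddC/divr_gt0].
Qed.

Lemma stable_quadratic (R : realType) (a2 a1 a0 : R) :
  0 < a2 -> 0 < a1 -> 0 < a0 -> stable (a2%:P * 'X^2 + a1%:P * 'X + a0%:P).
Proof.
move=> h2 h1 h0; pose b := a2 / (2 * a1).
have b0 : 0 < b by rewrite divr_gt0 // mulr_gt0.
have -> : a2 = b * 2 * a1 by rewrite /b; field; rewrite gt_eqF.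
have := stable_routh _ _ _ true (stable_linear _ _ _ h1 h0) b0.
congr stable.
rewrite !(comp_polyD, comp_polyM, comp_polyC, comp_polyX) expr1.
by ring.
Qed.

(** The cubic is a quadratic plus a multiple of ['X] times its even part, and
    [a3 * a0 < a2 * a1] says that this quadratic has positive coefficients; in
    the same way the Hurwitz inequality of a quartic is that of a cubic. *)
Lemma stable_cubic (R : realType) (a3 a2 a1 a0 : R) :
  0 < a3 -> 0 < a2 -> 0 < a0 -> a3 * a0 < a2 * a1 ->
  stable (a3%:P * 'X^3 + a2%:P * 'X^2 + a1%:P * 'X + a0%:P).
Proof.
move=> h3 h2 h0 H; pose b := a3 / (2 * a2).
have b0 : 0 < b by rewrite divr_gt0 // mulr_gt0.
have a3E : a3 = b * 2 * a2 by rewrite /b; field; rewrite gt_eqF.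
have c0 : 0 < a1 - 2 * b * a0.
  rewrite -(pmulr_rgt0 _ h2) mulrBr subr_gt0; apply: le_lt_trans H.
  by rewrite a3E le_eqVlt; apply/orP; left; apply/eqP; ring.
rewrite a3E.
have := stable_routh _ _ _ false (stable_quadratic _ _ _ _ h2 c0 h0) b0.
congr stable.
rewrite !(comp_polyD, comp_polyM, comp_polyC, comp_polyX, comp_Xn_poly) expr0.
by ring.
Qed.

Lemma stable_quartic (R : realType) (a4 a3 a2 a1 a0 : R) :
  0 < a4 -> 0 < a3 -> 0 < a1 -> 0 < a0 ->
  a4 * a1 ^+ 2 + a3 ^+ 2 * a0 < a3 * a2 * a1 ->
  stable (a4%:P * 'X^4 + a3%:P * 'X^3 + a2%:P * 'X^2 + a1%:P * 'X + a0%:P).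
Proof.
move=> h4 h3 h1 h0 H; pose b := a4 / (2 * a3).
have b0 : 0 < b by rewrite divr_gt0 // mulr_gt0.
have a4E : a4 = b * 2 * a3 by rewrite /b; field; rewrite gt_eqF.
have H' : a3 * a0 < (a2 - 2 * b * a1) * a1.
  rewrite -(ltr_pM2l h3) -subr_gt0.
  have -> : a3 * ((a2 - 2 * b * a1) * a1) - a3 * (a3 * a0)
      = a3 * a2 * a1 - (a4 * a1 ^+ 2 + a3 ^+ 2 * a0) by rewrite a4E; ring.
  by rewrite subr_gt0.
have c0 : 0 < a2 - 2 * b * a1.
  by rewrite -(pmulr_lgt0 _ h1); apply: lt_trans H'; rewrite mulr_gt0.
rewrite a4E.
have := stable_routh _ _ _ true (stable_cubic _ _ _ _ _ h3 c0 h0 H') b0.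
congr stable.
rewrite !(comp_polyD, comp_polyM, comp_polyC, comp_polyX, comp_Xn_poly) expr1.
by ring.
Qed.

(** * Explicit solutions *)

Lemma size_1addX (R : realType) (t : R) : t != 0 ->
  size (1 + t%:P * 'X) = 2%N.
Proof.
by move=> t0; rewrite addrC size_MXaddC polyC_eq0 (negPf t0) /= size_polyC t0.
Qed.

Lemma size_quadratic (R : realType) (a2 a1 a0 : R) : a2 != 0 ->
  size (a2%:P * 'X^2 + a1%:P * 'X + a0%:P) = 3%N.
Proof.
move=> h; rewrite exprS expr1 mulrA -mulrDl size_MXaddC size_MXaddC.
by rewrite -size_poly_eq0 size_MXaddC polyC_eq0 (negPf h) /= size_polyC h.
Qed.

Lemma size_quartic (R : realType) (a4 a3 a2 a1 a0 : R) : a4 != 0 ->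
  size (a4%:P * 'X^4 + a3%:P * 'X^3 + a2%:P * 'X^2 + a1%:P * 'X + a0%:P) = 5%N.
Proof.
move=> h.
have -> : a4%:P * 'X^4 + a3%:P * 'X^3 + a2%:P * 'X^2 + a1%:P * 'X + a0%:P
  = (a4%:P * 'X^2 + a3%:P * 'X + a2%:P) * 'X^2 + (a1%:P * 'X + a0%:P).
  by ring.
have q0 := size_quadratic R a4 a3 a2 h.
have s4 : size ((a4%:P * 'X^2 + a3%:P * 'X + a2%:P) * 'X^2) = 5%N.
  by rewrite size_mulXn ?q0 // -size_poly_eq0 q0.
rewrite size_polyDl // s4 size_MXaddC; case: ifP => // _.
by rewrite ltnS (leq_ltn_trans (size_polyC_leq1 _)).
Qed.

Lemma admissible_neg (R : realType) (d : R) : d < 0 ->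
  admissible_by d 1 (1 / 2)%:P.
Proof.
move=> d0; split.
- by apply: stableC; rewrite oner_eq0.
- by apply: stableC; rewrite gt_eqF //; lra.
- by rewrite size_poly1 size_polyC leq_b1.
have : stable ((1 + 1 / 2)%:P * 'X^2 + (- (2 * d))%:P * 'X + (1 - 1 / 2 : R)%:P).
  by apply: stable_quadratic; lra.
by congr stable; rewrite /closed_loop -mul_polyC; ring.
Qed.

(** The coefficients of [x] below the leading one are the first two of the power
    series of [(1 - s^2) (1 + tau s) / (s^2 - 2 d s + 1)], so the closed loop
    is divisible by [s^2]; for [tau = 1/5] and leading coefficient 1 the
    quotient has positive coefficients up to [d = 4/5]. *)
Lemma admissible_low (R : realType) (d : R) : 0 <= d -> d <= 4 / 5 ->
  exists x y : {poly R}, size x = 3%N /\ admissible_by d x y.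
Proof.
move=> d0 d1; pose t : R := 1 / 5.
have dd : d ^+ 2 <= 16 / 25 by rewrite expr2; nra.
pose x : {poly R} := 1%:P * 'X^2 + (2 * d + t)%:P * 'X + 1%:P.
have sx : size x = 3%N by rewrite size_quadratic // oner_eq0.
have sy : size (1 + t%:P * 'X) = 2%N by rewrite size_1addX // /t gt_eqF //; lra.
have [||||||||x' [y' [sE ad]]] := @admissible_of_zero_roots R d 2
  x (1 + t%:P * 'X)
  (1%:P * 'X^2 + (2 * t)%:P * 'X + (3 - 4 * d ^+ 2 - 2 * d * t)%:P).
- by apply/eqP; lra.
- by apply/eqP; lra.
- by apply: stable_quadratic; rewrite /t; lra.
- by rewrite addrC; apply: stable_linear; rewrite /t; lra.
- by apply: stable_quadratic; rewrite /t; lra.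
- by rewrite sy.
- by rewrite sx sy.
- by rewrite /closed_loop /x -mul_polyC; ring.
by exists x', y'; rewrite sE sx.
Qed.

(** Here [x] carries the first four coefficients [1, x1, x2, x3] of that power
    series and a free leading coefficient [k].  The closed loop is [s^4] times
    [k s^2 + e (U - k) s + (k - L)], so [k] has to lie between [max 0 L] and [U];
    for [k < U] the Hurwitz inequality of [x] holds as well.  The choice
    [tau = e g] makes [U - L] equal to [g (4 D - D^2 - 1)], where
    [g = 5 D - 5 - D^2] is positive, for [d] in this range, precisely below the extremal value. *)
Lemma admissible_high (R : realType) (d : R) : 4 / 5 <= d -> d < 1 ->
  16 * d ^+ 4 - 20 * d ^+ 2 + 5 < 0 ->
  exists x y : {poly R}, size x = 5%N /\ admissible_by d x y.
Proof.
move=> d0 d1 H; pose e := 2 * d; pose D := e ^+ 2.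
have e0 : 8 / 5 <= e by rewrite /e; lra.
have e_gt0 : 0 < e by lra.
have DE : D = e * e by rewrite /D expr2.
have D0 : 64 / 25 <= D by rewrite DE; nra.
pose g := 5 * D - 5 - D ^+ 2.
have g0 : 0 < g.
  have -> : g = - (16 * d ^+ 4 - 20 * d ^+ 2 + 5) by rewrite /g /D /e; ring.
  by rewrite oppr_gt0.
have D1 : D < 37 / 10.
  by rewrite ltNge; apply/negP => ?; move: g0; rewrite /g; nra.
pose t := e * g; have t0 : 0 < t by rewrite mulr_gt0.
pose U := D - 3 + g * (D - 2).
pose L := D ^+ 2 - 4 * D + 2 + e * t * (D - 3).
have U0 : 0 < U.
  have [D3|D3] := leP 3 D.
    have : 0 < g * (D - 2) by rewrite mulr_gt0 //; lra.
    by rewrite /U; lra.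
  have : 1 <= g by rewrite /g; nra.
  by rewrite /U; nra.
have LU : L < U.
  have -> : U = L + g * (4 * D - D ^+ 2 - 1).
    by rewrite /U /L /t mulrA -DE /g; ring.
  by rewrite ltrDl mulr_gt0 //; nra.
pose k := (Num.max 0 L + U) / 2.
have mU : Num.max 0 L < U by rewrite gt_max U0.
have m0 : 0 <= Num.max 0 L by rewrite le_max lexx.
have mL : L <= Num.max 0 L by rewrite le_max lexx orbT.
have k0 : 0 < k by rewrite /k; lra.
have kU : k < U by rewrite /k; lra.
have Lk : L < k by rewrite /k; lra.
pose x1 := e + t; pose x2 := e * x1 - 2; pose x3 := e * U.
pose x : {poly R} :=
  k%:P * 'X^4 + x3%:P * 'X^3 + x2%:P * 'X^2 + x1%:P * 'X + 1%:P.
have sx : size x = 5%N by rewrite size_quartic // gt_eqF.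
have sy : size (1 + t%:P * 'X) = 2%N by rewrite size_1addX // gt_eqF.
have x3_gt0 : 0 < x3 by rewrite mulr_gt0.
have x1_gt0 : 0 < x1 by rewrite addr_gt0.
have [||||||||x' [y' [sE ad]]] := @admissible_of_zero_roots R d 4
  x (1 + t%:P * 'X) (k%:P * 'X^2 + (e * (U - k))%:P * 'X + (k - L)%:P).
- by apply/eqP; lra.
- by apply/eqP; lra.
- apply: stable_quartic => //.
  (* with k replaced by U, the Hurwitz inequality holds for all positive tau *)
  have kx : k * x1 ^+ 2 < U * x1 ^+ 2 by rewrite ltr_pM2r // exprn_gt0.
  apply: lt_le_trans (_ : U * x1 ^+ 2 + x3 ^+ 2 * 1 <= _); first by lra.
  rewrite -subr_ge0.
  have -> : x3 * x2 * x1 - (U * x1 ^+ 2 + x3 ^+ 2 * 1)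
     = U * (t * (e * (D - 2) + t * (D - 1))).
    by rewrite /x3 /x2 /U /x1 /t DE; ring.
  apply: mulr_ge0; first exact: ltW.
  apply: mulr_ge0; first exact: ltW.
  by rewrite addr_ge0 // mulr_ge0 //; lra.
- by rewrite addrC; apply: stable_linear.
- by apply: stable_quadratic => //; [rewrite mulr_gt0 //|]; lra.
- by rewrite sy.
- by rewrite sx sy.
- rewrite /closed_loop /x -mul_polyC /x3 /x2 /x1 /U /L /t DE /e; ring.
by exists x', y'; rewrite sE sx.
Qed.

Lemma quasi_stable_sqr_add (R : realType) (c : R) : 0 <= c ->
  quasi_stable ('X^2 + c%:P).
Proof.
move=> c0 [a b]; rewrite rmorphD rmorphXn /= map_polyC map_polyX /root.
rewrite !hornerE /= => /eqP [h1 h2]; rewrite leNgt; apply/negP => a0.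
have : a * b == 0 by apply/eqP; lra.
by rewrite mulf_eq0 gt_eqF //= => /eqP b0; move: h1; rewrite b0; nra.
Qed.

Theorem theorem4p2 (R : realType) :
  (exists x y : {poly R},
      (size x <= 5)%N /\
      quasi_admissible_by (Num.sqrt (10 + 2 * Num.sqrt 5) / 4) x y) /\
  (forall delta : R,
      delta < Num.sqrt (10 + 2 * Num.sqrt 5) / 4 ->
      exists x y : {poly R},
        (size x <= 5)%N /\ admissible_by delta x y).
Proof.
set r := Num.sqrt 5; set s := Num.sqrt (10 + 2 * r).
have r0 : 0 <= r by apply: sqrtr_ge0.
have rr : r ^+ 2 = 5 by rewrite sqr_sqrtr.
have s0 : 0 <= s by apply: sqrtr_ge0.
have ss : s ^+ 2 = 10 + 2 * r by rewrite sqr_sqrtr //; lra.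
have r2 : 2 < r by nra.
have r3 : r < 3 by nra.
have s_lt4 : s < 4 by nra.
have s_gt3 : 3 < s by nra.
split.
  pose d := s / 4; pose p := (1 + r) / 2.
  have dd : 4 * d ^+ 2 = p + 2 by rewrite /d /p expr_div_n ss; field.
  have pp : p ^+ 2 = p + 1 by rewrite /p expr_div_n sqrrD rr; field.
  have p0 : 0 < p by rewrite /p; lra.
  have d0 : 0 < d by rewrite /d; lra.
  pose X : {poly R} := (1%:P * 'X^2 + (2 * d)%:P * 'X + 1%:P)
                       * ('X^2 + p%:P).
  exists X, p%:P; rewrite -/d.
  have s1 := size_quadratic R 1 (2 * d) 1 (oner_neq0 R).
  have s2 : size ('X^2 + p%:P) = 3%N by rewrite size_XnaddC.
  have sX : size X = 5%N.
    by rewrite /X size_mul ?s1 ?s2 // -size_poly_eq0 ?s1 ?s2.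
  rewrite sX; split=> //; split.
  - move=> z; rewrite /X rmorphM rootM => /orP[].
      move/(@stable_quadratic R _ _ _ _ _ _ z) => H.
      by apply: ltW; apply: H; lra.
    by apply: quasi_stable_sqr_add; apply: ltW.
  - move=> z; rewrite map_polyC rootC /= fmorph_eq0 => /eqP; lra.
  - by rewrite sX size_polyC gt_eqF.
  have -> : closed_loop d X p%:P = 'X^6.
    have hp : (p%:P : {poly R}) ^+ 2 = p%:P + 1 by rewrite -polyC_exp pp polyCD.
    have hd : ((2 * d)%:P : {poly R}) ^+ 2 = p%:P + 2%:P.
      by rewrite -polyC_exp exprMn -polyCD -dd; congr polyC; ring.
    transitivity ('X^6 + (p%:P + 1 - p%:P ^+ 2) * 'X^2
        + (p%:P + 2%:P - (2 * d)%:P ^+ 2) * 'X^2 * ('X^2 + p%:P)).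
      by rewrite /closed_loop /X -mul_polyC; ring.
    by rewrite hp hd !subrr !mul0r !addr0.
  by move=> z; rewrite map_polyXn /root hornerXn expf_eq0 => /eqP ->.
move=> d ds.
have [d0|d0] := ltP d 0.
  by exists 1, (1 / 2)%:P; rewrite size_poly1; split=> //; apply: admissible_neg.
have [d1|d1] := leP d (4 / 5).
  by have [x [y [sx ad]]] := admissible_low R d d0 d1; exists x, y; rewrite sx.
have [|||x [y [sx ad]]] := admissible_high R d.
- exact: ltW.
- lra.
- (* with D = 4 d^2, the claim is D^2 - 5 D + 5 < 0, that is (2 D - 5)^2 < 5 *)
  have : (8 * d ^+ 2 - 5) ^+ 2 < 5.
    have : (4 * d) ^+ 2 < s ^+ 2 by rewrite ltrXn2r // ?nnegrE; lra.
    have : (16 / 5) ^+ 2 <= (4 * d) ^+ 2 by rewrite lerXn2r // ?nnegrE; lra.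
    rewrite ss exprMn => h1 h2; rewrite -rr ltrXn2r // ?nnegrE; lra.
  by rewrite sqrrB exprMn -exprM => h; lra.
by exists x, y; rewrite sx.
Qed.
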